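(* Let $G=(V,E)$ be the Soccer Ball Graph (SBG). The minimum cardinality of an Identifying Code Set of $G$ is at most ten.
   Context: For a finite undirected simple graph $G=(V,E)$ and $v\in V$, let $N(v)$ be the set of vertices adjacent to $v$ and $N^+(v)=\{v\}\cup N(v)$. A set $V'\subseteq V$ is an Identifying Code Set (ICS) of $G$ if $N^+(v)\cap V'\neq\varnothing$ for every $v\in V$, and $N^+(v)\cap V'\neq N^+(w)\cap V'$ for all $v,w\in V$ with $v\ne w$. A Minimum Identifying Code Set (MICS) is an ICS of smallest cardinality. The Soccer Ball Graph (SBG) has 32 vertices corresponding to the 20 hexagonal and 12 pentagonal faces of a truncated icosahedron, two vertices being adjacent iff the corresponding faces share a boundary edge (90 edges). Explicitly, $V=P\cup H$ with $P=\{P_{1,1}\}\cup\{P_{i,j}: i\in\{3,4\},1\le j\le5\}\cup\{P_{6,1}\}$ and $H=\{H_{i,j}: 2\le i\le 5, 1\le j\le 5\}$. Second indices $j$ (of the vertices with first index $2,\dots,5$) are taken modulo 5 with representatives $1,\dots,5$. The edges are, for all $1\le j\le5$: $\{P_{1,1},H_{2,j}\}$, $\{P_{6,1},H_{5,j}\}$, $\{H_{2,j},H_{2,j+1}\}$, $\{H_{5,j},H_{5,j+1}\}$, $\{H_{3,j},P_{3,j}\}$, $\{P_{3,j},H_{3,j+1}\}$, $\{H_{4,j},P_{4,j+1}\}$, $\{P_{4,j},H_{4,j}\}$, $\{H_{2,j},H_{3,j}\}$, $\{H_{2,j},P_{3,j-1}\}$, $\{H_{2,j},P_{3,j}\}$,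 $\{H_{3,j},P_{4,j}\}$, $\{H_{3,j},H_{4,j-1}\}$, $\{H_{3,j},H_{4,j}\}$, $\{P_{3,j},H_{4,j}\}$, $\{H_{4,j},H_{5,j}\}$, $\{P_{4,j},H_{5,j}\}$, $\{P_{4,j},H_{5,j-1}\}$. *)

(* Defs.v *)
From HB Require Import structures.
From mathcomp Require Import all_boot all_order all_algebra.
Set Implicit Arguments.
Unset Strict Implicit.
Unset Printing Implicit Defensive.
Import GRing.Theory.
Local Open Scope ring_scope.

Record sgraph := SGraph {
  svertex :> finType;
  sedge : rel svertex;
  sedge_sym : symmetric sedge;
  sedge_irrefl : irreflexive sedge }.

Definition open_nbhd (G : sgraph) (v : G) : {set G} := [set w | sedge v w].

Definition closed_nbhd (G : sgraph) (v : G) : {set G} := v |: open_nbhd v.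

Definition ICS (G : sgraph) (C : {set G}) : Prop :=
  (forall v : G, closed_nbhd v :&: C != set0) /\
  (forall v w : G, v != w -> closed_nbhd v :&: C != closed_nbhd w :&: C).

Definition MICS (G : sgraph) (C : {set G}) : Prop :=
  ICS C /\ forall D : {set G}, ICS D -> (#|C| <= #|D|)%N.

(* [P1] and [P6] are the vertices P_{1,1} and P_{6,1}; [Hi j] and [Pi j] are
   H_{i,j} and P_{i,j}, the index j being taken in the ring Z/5Z, so that the
   representative 5 is 0. *)
Inductive sbg_vertex : Type :=
  | P1 | P6
  | P3 of 'Z_5 | P4 of 'Z_5
  | H2 of 'Z_5 | H3 of 'Z_5 | H4 of 'Z_5 | H5 of 'Z_5.

Definition sbg_code (v : sbg_vertex) : bool + 'I_6 * 'Z_5 :=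
  match v with
  | P1 => inl true | P6 => inl false
  | P3 j => inr (inord 0, j) | P4 j => inr (inord 1, j)
  | H2 j => inr (inord 2, j) | H3 j => inr (inord 3, j)
  | H4 j => inr (inord 4, j) | H5 j => inr (inord 5, j)
  end.

Definition sbg_decode (c : bool + 'I_6 * 'Z_5) : sbg_vertex :=
  match c with
  | inl b => if b then P1 else P6
  | inr (i, j) =>
      match val i with
      | 0 => P3 j | 1 => P4 j | 2 => H2 j | 3 => H3 j | 4 => H4 j | _ => H5 j
      end%N
  end.

Lemma sbg_codeK : cancel sbg_code sbg_decode.
Proof. by case=> [||j|j|j|j|j|j] //=; rewrite inordK. Qed.

HB.instance Definition _ := Finite.copy sbg_vertex (can_type sbg_codeK).

(* Each edge of the soccer ball graph is listed here in one orientation. *)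
Definition sbg_arc (x y : sbg_vertex) : bool :=
  match x, y with
  | P1, H2 _ => true
  | P6, H5 _ => true
  | H2 j, H2 k => k == j + 1
  | H5 j, H5 k => k == j + 1
  | H3 j, P3 k => k == j
  | P3 j, H3 k => k == j + 1
  | H4 j, P4 k => k == j + 1
  | P4 j, H4 k => k == j
  | H2 j, H3 k => k == j
  | H2 j, P3 k => (k == j - 1) || (k == j)
  | H3 j, P4 k => k == j
  | H3 j, H4 k => (k == j - 1) || (k == j)
  | P3 j, H4 k => k == j
  | H4 j, H5 k => k == j
  | P4 j, H5 k => (k == j) || (k == j - 1)
  | _, _ => false
  end.

Definition sbg_edge : rel sbg_vertex := fun x y => sbg_arc x y || sbg_arc y x.

Lemma sbg_edge_sym : symmetric sbg_edge.
Proof. by move=> x y; rewrite /sbg_edge orbC. Qed.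

Lemma sbg_edge_irrefl : irreflexive sbg_edge.
Proof.
have neS (j : 'Z_5) : (j == j + 1) = false.
  by rewrite -{1}[j]addr0 (inj_eq (addrI j)).
by case=> [||j|j|j|j|j|j]; rewrite /sbg_edge /= ?neS.
Qed.

Definition SBG : sgraph := SGraph sbg_edge_sym sbg_edge_irrefl.

(* Main.v *)
Require Import Defs.
From mathcomp Require Import all_boot all_order all_algebra.

(** The ten vertices of [sbg_ics] form an identifying code set, found by a
    computer search.  That they do is a finite check over the 32 vertices; a
    minimum identifying code set then exists and is no larger. *)

Lemma MICS_exists (G : sgraph) (C : {set G}) :
  ICS C -> exists D : {set G}, MICS D /\ #|D| <= #|C|.
Proof.
(* A boolean form of [ICS], since [arg_minnP] minimises over a decidable predicate. *)
pose icsb (D : {set G}) :=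
  [forall v : G, closed_nbhd v :&: D != set0] &&
  [forall v : G, forall w : G, (v != w) ==>
     (closed_nbhd v :&: D != closed_nbhd w :&: D)].
have icsP D : reflect (ICS D) (icsb D).
  apply: (iffP andP) => [[/forallP dom /forallP sep]|[dom sep]].
    by split=> // v w; move/forallP/(_ w)/implyP: (sep v).
  split; apply/forallP=> // v; apply/forallP=> w; apply/implyP; exact: sep.
move=> /icsP icsC; case: (arg_minnP (fun D : {set G} => #|D|) icsC) => D icsD minD.
exists D; split; last exact: minD.
by split=> [|D' /icsP]; [apply/icsP | apply: minD].
Qed.

(* Equality on [sbg_vertex] is transported along [sbg_code], whose [inord]
   blocks evaluation; [sbg_eqb] computes. *)
Definition sbg_eqb (v w : sbg_vertex) : bool :=
  match v, w with
  | P1, P1 | P6, P6 => true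
  | P3 j, P3 k | P4 j, P4 k | H2 j, H2 k
  | H3 j, H3 k | H4 j, H4 k | H5 j, H5 k => j == k
  | _, _ => false
  end.

Lemma sbg_eqbP : Equality.axiom sbg_eqb.
Proof.
by case=> [||j|j|j|j|j|j] [||k|k|k|k|k|k]; rewrite /=;
  first [by constructor | by apply: (iffP eqP) => [-> | [->]]].
Qed.

(** An explicit list that evaluates, unlike the enumeration of the [finType]; quantifiers over
    vertices become [all]. *)
Definition sbg_vertices : seq sbg_vertex :=
  [:: P1; P6] ++
  flatten [seq [:: P3 j; P4 j; H2 j; H3 j; H4 j; H5 j] | j <- map inZp (iota 0 5)].

Lemma mem_sbg_vertices (v : sbg_vertex) : v \in sbg_vertices.
Proof.
have Z5 (j : 'Z_5) : j \in map inZp (iota 0 5).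
  by rewrite -[j]valZpK map_f // mem_iota ltn_ord.
rewrite mem_cat; case: v => [||j|j|j|j|j|j]; apply/orP; [by left | by left | right..].
all: by apply/flatten_mapP; exists j; rewrite ?Z5 // !inE eqxx ?orbT.
Qed.

Definition sbg_ics : seq sbg_vertex :=
  [:: P6; P3 (inZp 3); P4 (inZp 0); P4 (inZp 2); P4 (inZp 3); P4 (inZp 4);
      H2 (inZp 0); H2 (inZp 1); H2 (inZp 2); H3 (inZp 1)].

(** The characteristic vector of $N^+(v) \cap V'$ along the list [sbg_ics]: domination means a true
    bit, separation means injectivity. *)
Definition sbg_trace (v : sbg_vertex) : bitseq :=
  [seq sbg_eqb c v || sbg_edge v c | c <- sbg_ics].

Lemma sbg_trace_dominating : all (fun v => has id (sbg_trace v)) sbg_vertices.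
Proof. by vm_compute. Qed.

Lemma sbg_trace_separating :
  all (fun v => all (fun w => (sbg_trace v == sbg_trace w) ==> sbg_eqb v w)
                    sbg_vertices) sbg_vertices.
Proof. by vm_compute. Qed.

Lemma sbg_trace_inj : injective sbg_trace.
Proof.
move=> v w /eqP eq_vw; apply/sbg_eqbP.
have /allP/(_ w (mem_sbg_vertices w)) :=
  allP sbg_trace_separating v (mem_sbg_vertices v).
by rewrite eq_vw.
Qed.

Lemma sbg_traceE (v c : SBG) :
  (c \in closed_nbhd v) = sbg_eqb c v || sbg_edge v c.
Proof. by rewrite !inE (sameP (sbg_eqbP c v) eqP). Qed.

Lemma sbg_ics_ICS : ICS ([set c in sbg_ics] : {set SBG}).
Proof.
split=> [v|v w].
  have := allP sbg_trace_dominating v (mem_sbg_vertices v).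
  rewrite has_map => /hasP[c c_ics c_v]; apply/set0Pn; exists c.
  by rewrite inE sbg_traceE inE c_ics andbT.
(* Equal intersections agree at each [c] of the code, so the two traces agree bit by bit and
   injectivity applies. *)
apply: contraNneq => /setP eq_vw; apply/eqP/sbg_trace_inj/eq_in_map => c c_ics.
by have := eq_vw c; rewrite !in_setI !sbg_traceE inE c_ics !andbT.
Qed.

Theorem theorem1 : exists C : {set SBG}, MICS C /\ (#|C| <= 10)%N.
Proof.
have [C [micsC leC]] := MICS_exists _ _ sbg_ics_ICS.
exists C; split=> //; apply: leq_trans leC _.
(* The bound 10 is the length of [sbg_ics]. *)
by rewrite cardsE; apply: (card_size sbg_ics).
Qed.
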